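(* Let $V$ and $W$ be two forms in the same variables $x\in\mathbb{R}^n$, of possibly different degree. If $W$ is positive definite, and $\langle \nabla W, \nabla V \rangle$ is positive definite, then $V$ is positive definite.
   Context: A form is a homogeneous polynomial with real coefficients (all monomials have the same degree). A form $q$ in $n$ variables is positive definite if $q(x)>0$ for all $x\neq 0$ in $\mathbb{R}^n$. $\nabla$ denotes the gradient and $\langle\cdot,\cdot\rangle$ the standard inner product on $\mathbb{R}^n$, so $\langle \nabla W,\nabla V\rangle$ is the form $x\mapsto \sum_{i=1}^n \frac{\partial W}{\partial x_i}(x)\frac{\partial V}{\partial x_i}(x)$. *)

(* Defs.v *)
From HB Require Import structures.
From mathcomp Require Import all_boot all_order all_algebra.
From mathcomp Require Import mpoly.
From mathcomp Require Import reals.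

Set Implicit Arguments.
Unset Strict Implicit.
Unset Printing Implicit Defensive.

Import Order.TTheory GRing.Theory Num.Theory.
Local Open Scope ring_scope.

(* The hypothesis x != 0 is vacuous for n = 0, and the zero polynomial (which
   is d.-homog for every d) is not positive definite as soon as n > 0. *)
Definition posdef (R : realType) (n : nat) (q : {mpoly R[n]}) : Prop :=
  forall x : 'rV[R]_n, x != 0 -> 0 < q.@[fun i => x 0 i].

Definition grad (R : realType) (n : nat) (p : {mpoly R[n]}) :
    'rV[{mpoly R[n]}]_n :=
  \row_(i < n) p^`M(i).

Definition inner (A : comNzRingType) (n : nat) (u v : 'rV[A]_n) : A :=
  \sum_(i < n) u 0 i * v 0 i.

(* Main.v *)
Require Import Defs.
From HB Require Import structures.
From mathcomp Require Import all_boot all_order all_algebra.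
From mathcomp Require Import mpoly.
From mathcomp Require Import reals.
From mathcomp Require Import boolp classical_sets topology normedtype derive.
From mathcomp Require Import ring lra.

(** If [V y <= 0] for some [y != 0], minimise [V] over the compact sublevel set
    [W <= W y]. Some minimiser is nonzero: [y] itself if the minimum is
    [0 = V 0], any minimiser otherwise. But at a nonzero point of the sublevel
    set a small step along [- grad W] decreases both [V], because
    [<grad W, grad V> > 0], and [W], because [grad W != 0]: the point stays in
    the sublevel set, contradicting minimality. *)

Set Implicit Arguments.
Unset Strict Implicit.
Unset Printing Implicit Defensive.

Import Order.TTheory GRing.Theory Num.Theory.
Import numFieldNormedType.Exports.
Local Open Scope ring_scope.

(** Constants and variables generate the polynomials as a ring; this induction serves the Taylor
    expansion and continuity. *)
Lemma mpoly_alg_ind (R : nzRingType) (n : nat) (P : {mpoly R[n]} -> Prop) :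
    (forall c, P c%:MP) -> (forall i, P 'X_i) ->
    (forall p q, P p -> P q -> P (p + q)) ->
    (forall p q, P p -> P q -> P (p * q)) ->
  forall p, P p.
Proof.
move=> PC PX PD PM; elim/mpolyind => [|c m p _ _ Pp]; first by rewrite -mpolyC0.
apply: (PD) => //; rewrite -mul_mpolyC; apply: (PM) => //.
rewrite mpolyXE_id; elim/big_ind: _ => // [|i _]; first by rewrite -mpolyC1.
elim: (m i) => [|k Pk]; first by rewrite expr0 -mpolyC1.
by rewrite exprS; apply: PM.
Qed.

Lemma meval_homog_scale (R : comNzRingType) (n d : nat) (p : {mpoly R[n]})
    (x : 'I_n -> R) (t : R) :
  p \is d.-homog -> p.@[fun i => t * x i] = t ^+ d * p.@[x].
Proof.
move=> /dhomogP p_homog; rewrite !mevalE mulr_sumr.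
apply: eq_big_seq => m /p_homog /= <-.
under eq_bigr do rewrite exprMn.
by rewrite big_split /= -expr_sum mulrCA mdegE.
Qed.

Lemma mderiv_homog0 (R : nzRingType) (n : nat) (p : {mpoly R[n]}) (i : 'I_n) :
  p \is 0.-homog -> p^`M(i) = 0.
Proof.
move=> /dhomogP p_homog; rewrite [p]mpolyE raddf_sum big_seq big1 //= => m.
move=> /p_homog/eqP /=; rewrite mdeg_eq0 => /eqP ->.
by rewrite mderivZ mpolyX0 -mpolyC1 mderivC scaler0.
Qed.

(** The expansion survives sums and products, so checking generators suffices. Keeping the remainder
    a polynomial in [t] makes it bounded near 0. *)
Lemma meval_taylor1 (R : comNzRingType) (n : nat) (p : {mpoly R[n]})
    (x v : 'I_n -> R) :
  exists r : {poly R}, forall t,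
    p.@[fun i => x i + t * v i] =
      p.@[x] + t * (\sum_(i < n) p^`M(i).@[x] * v i) + t ^+ 2 * r.[t].
Proof.
elim/mpoly_alg_ind: p => [c|j|p q [r pE] [s qE]|p q [r pE] [s qE]].
- exists 0 => t; rewrite big1 => [|i _]; last by rewrite mderivC meval0 mul0r.
  by rewrite !mevalC horner0 !mulr0 !addr0.
- exists 0 => t; rewrite (bigD1 j) //= big1 => [|i ij].
    have subUU : (U_(j) - U_(j) = 0)%MM.
      by apply/mnmP => k; rewrite mnmBE subnn mnm0E.
    rewrite mderivX mnm1E eqxx scale1r subUU mpolyX0 meval1 !mevalXU horner0.
    by ring.
  by rewrite mderivX mnm1E eq_sym (negbTE ij) scale0r meval0 mul0r.
- exists (r + s) => t; rewrite !mevalD pE qE hornerD.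
  under [in RHS]eq_bigr do rewrite mderivD mevalD mulrDl.
  by rewrite big_split /=; ring.
set a := \sum_(i < n) p^`M(i).@[x] * v i in pE.
set b := \sum_(i < n) q^`M(i).@[x] * v i in qE.
(* The terms of order at least 2 in [(p x + t a + t^2 r) (q x + t b + t^2 s)], divided by [t^2]. *)
exists ((a * b)%:P + (p.@[x])%:P * s + (q.@[x])%:P * r
        + 'X * (a%:P * s + b%:P * r) + 'X ^+ 2 * r * s) => t.
rewrite !mevalM pE qE !hornerE.
have -> : \sum_(i < n) (p * q)^`M(i).@[x] * v i = a * q.@[x] + p.@[x] * b.
  rewrite mulr_suml mulr_sumr -big_split /=.
  by apply: eq_bigr => i _; rewrite mderivM mevalD !mevalM; ring.
by ring.
Qed.

Lemma meval_descent (R : realFieldType) (n : nat) (p : {mpoly R[n]})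
    (x v : 'I_n -> R) :
  \sum_(i < n) p^`M(i).@[x] * v i < 0 ->
  exists2 e : R, 0 < e &
    forall t, 0 < t < e -> p.@[fun i => x i + t * v i] < p.@[x].
Proof.
have [r pE] := meval_taylor1 p x v; set s := \sum_(i < n) _ in pE *; move=> s0.
have [b rb] := poly_disk_bound r 1.
have b0 : 0 <= b by rewrite (le_trans (normr_ge0 r.[0])) // rb ?normr0 ?ler01.
have b1 : 0 < b + 1 by lra.
(* The bound [b] on [r] holds for [t <= 1], and then [t * r.[t] <= t * b < - s], so the slope [s]
   dominates. Dividing by [b + 1] covers [b = 0]. *)
exists (Num.min 1 (- s / (b + 1))).
  by rewrite lt_min ltr01 divr_gt0 // oppr_gt0.
move=> t /andP[t0]; rewrite lt_min ltr_pdivlMr // => /andP[t1 ts].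
have /(le_trans (ler_norm _)) rtb : `|r.[t]| <= b.
  by rewrite rb // ger0_norm ltW.
have : t * (s + t * r.[t]) < 0 by rewrite pmulr_rlt0 //; nra.
by rewrite pE; lra.
Qed.

Section RealForms.
Variables (R : realType) (n : nat).
Implicit Types (p q V W : {mpoly R[n]}) (x : 'rV[R]_n).

Local Notation ev p x := (p.@[fun i => x 0 i]).

Lemma meval_continuous p : continuous (fun x => ev p x).
Proof.
elim/mpoly_alg_ind: p => [c|j|p q pc qc|p q pc qc] x.
- under [X in continuous_at _ X]eq_fun do rewrite mevalC.
  exact: cst_continuous.
- under [X in continuous_at _ X]eq_fun do rewrite mevalXU.
  exact: coord_continuous.
- under [X in continuous_at _ X]eq_fun do rewrite mevalD.
  exact: (continuousD (pc x) (qc x)).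
- under [X in continuous_at _ X]eq_fun do rewrite mevalM.
  exact: (continuousM (pc x) (qc x)).
Qed.

Lemma ev_homog_scale d p x t :
  p \is d.-homog -> ev p (t *: x) = t ^+ d * ev p x.
Proof.
move=> p_homog; rewrite -meval_homog_scale //.
by apply: meval_eq => i; rewrite mxE.
Qed.

(** Take for [c] the minimum of [W] on the compact unit sphere, positive by definiteness;
    homogeneity carries the bound to every other point. *)
Lemma homog_posdef_ge d W : W \is d.-homog -> posdef W ->
  exists2 c : R, 0 < c & forall x, x != 0 -> c * `|x| ^+ d <= ev W x.
Proof.
move=> W_homog W_pos; pose S := [set x : 'rV[R]_n | `|x| = 1]%classic.
have toS x : x != 0 -> S (`|x|^-1 *: x).
  by move=> x0; rewrite /S /= normrZ normfV normr_id mulVf // normr_eq0.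
(* An empty sphere means there is no nonzero vector ([n = 0]), so any [c] works. *)
have [S0|S0] := pselect (S !=set0)%classic; last first.
  by exists 1 => // x /toS Sx; case: S0; eexists; exact: Sx.
have S_compact : compact S.
  apply: bounded_closed_compact.
    by exists 1; split=> // M M1 x /= ->; exact: ltW.
  apply: (@preimage_closed _ _ (fun x : 'rV[R]_n => `|x| : R) [set 1]%classic).
    by move=> x _; exact: norm_continuous.
  exact: closed_eq.
have [z /set_mem zS z_min] := EVT_min_rV S0 S_compact
  (continuous_subspaceT (@meval_continuous W)).
have z0 : z != 0 by rewrite -normr_eq0 zS oner_eq0.
exists (ev W z); first exact: W_pos.
move=> x x0; have nx0 : `|x| != 0 by rewrite normr_eq0.
have := z_min _ (mem_set (toS x x0)).
rewrite (ev_homog_scale _ _ W_homog) exprVn mulrC ler_pdivlMr //.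
by rewrite exprn_gt0 // normr_gt0.
Qed.

Lemma homog_posdef_sublevel_compact d W (a : R) :
  W \is d.-homog -> (0 < d)%N -> posdef W ->
  compact [set x : 'rV[R]_n | ev W x <= a]%classic.
Proof.
move=> W_homog d0 W_pos; apply: bounded_closed_compact; last first.
  apply: (@preimage_closed _ _ (fun x => ev W x) [set t | t <= a]%classic).
    by move=> x _; exact: meval_continuous.
  exact: closed_le.
have [c c0 Wc] := homog_posdef_ge W_homog W_pos.
(* Beyond radius 1, [|x| <= |x| ^+ d] because [d > 0], hence [c * |x| <= W x <= a]; this fails
   beyond [a / c]. *)
exists (Num.max 1 (a / c)); split; first exact: num_real.
move=> M; rewrite gt_max ltr_pdivrMr // => /andP[M1 aM] x /= Wxa.
rewrite leNgt; apply/negP => Mx.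
have x0 : x != 0 by rewrite -normr_gt0; lra.
have xd : `|x| <= `|x| ^+ d by rewrite ler_eXnr //; lra.
by have := Wc x x0; nra.
Qed.

Lemma ev_inner_grad V W x :
  ev (inner (grad W) (grad V)) x = \sum_(i < n) ev W^`M(i) x * ev V^`M(i) x.
Proof.
rewrite /inner raddf_sum /=.
by apply: eq_bigr => i _; rewrite !mxE mevalM.
Qed.

(** Along [v = - grad W] the slope of [V] is [- <grad W, grad V>] and that of [W] is [- |grad W|^2];
    both are negative. *)
Lemma common_descent V W x : 0 < ev (inner (grad W) (grad V)) x ->
  exists x', ev V x' < ev V x /\ ev W x' < ev W x.
Proof.
rewrite ev_inner_grad => WV0; pose v i := - ev W^`M(i) x.
have [e e0 Ve] : exists2 e : R, 0 < e & forall t, 0 < t < e ->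
    V.@[fun i => x 0 i + t * v i] < ev V x.
  apply: meval_descent; rewrite -oppr_gt0 -sumrN.
  by under eq_bigr do rewrite mulrN opprK mulrC.
have [f f0 Wf] : exists2 f : R, 0 < f & forall t, 0 < t < f ->
    W.@[fun i => x 0 i + t * v i] < ev W x.
  apply: meval_descent; rewrite -oppr_gt0 -sumrN.
  under eq_bigr do rewrite mulrN opprK -expr2.
  rewrite lt_neqAle sumr_ge0 ?andbT => [|i _]; last exact: sqr_ge0.
  (* A zero sum of squares would kill every partial derivative of [W] at [x], and with them the
     positive inner product. *)
  apply: contraTneq WV0 => /esym/eqP.
  rewrite psumr_eq0 => [/allP W0|i _]; last exact: sqr_ge0.
  rewrite big1 ?ltxx // => i _.
  have /= := W0 i (mem_index_enum i).
  by rewrite sqrf_eq0 => /eqP ->; rewrite mul0r.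
pose t := Num.min e f / 2.
have m0 : 0 < Num.min e f by rewrite lt_min e0.
have [me mf] : Num.min e f <= e /\ Num.min e f <= f by rewrite !ge_min !lexx orbT.
exists (x + t *: \row_i v i).
have xE p : ev p (x + t *: \row_i v i) = p.@[fun i => x 0 i + t * v i].
  by apply: meval_eq => i; rewrite !mxE.
by rewrite !xE; split; [apply: Ve | apply: Wf]; rewrite /t; lra.
Qed.

End RealForms.

Theorem mainTheorem5 (R : realType) (n dV dW : nat) (V W : {mpoly R[n]})
  (V_form : V \is dV.-homog) (W_form : W \is dW.-homog)
  (W_posdef : posdef W)
  (grad_posdef : posdef (inner (grad W) (grad V))) :
  posdef V.
Proof.
move=> y y0.
(* A form of degree 0 has zero gradient, against positivity at [y]. Positive degree of [W] gives
   compact sublevel sets, that of [V] gives [V 0 = 0]. *)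
have dW0 : (0 < dW)%N.
  case: dW W_form => // W0; have := grad_posdef y y0.
  rewrite ev_inner_grad big1 ?ltxx // => i _.
  by rewrite (mderiv_homog0 i W0) meval0 mul0r.
have dV0 : (0 < dV)%N.
  case: dV V_form => // V0; have := grad_posdef y y0.
  rewrite ev_inner_grad big1 ?ltxx // => i _.
  by rewrite (mderiv_homog0 i V0) meval0 mulr0.
have V0 : V.@[fun i => (0 : 'rV[R]_n) 0 i] = 0.
  by rewrite -(scale0r 0) (ev_homog_scale _ _ V_form) expr0n gtn_eqF // mul0r.
rewrite ltNge; apply/negP => Vy.
pose K := [set x : 'rV[R]_n | W.@[fun i => x 0 i] <= W.@[fun i => y 0 i]]%classic.
have Ky : K y by exact: lexx.
have K_compact : compact K.
  exact: homog_posdef_sublevel_compact W_form dW0 W_posdef.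
have [z /set_mem Kz z_min] := EVT_min_rV (ex_intro _ y Ky) K_compact
  (continuous_subspaceT (@meval_continuous R n V)).
have [u [u0 Ku u_min]] : exists u, [/\ u != 0, K u &
    forall x, K x -> V.@[fun i => u 0 i] <= V.@[fun i => x 0 i]].
  have [zE|z0] := eqVneq z 0.
    exists y; split=> // x /mem_set /z_min; apply: le_trans.
    by rewrite zE V0.
  by exists z; split=> // x /mem_set /z_min.
have [x [Vx Wx]] := common_descent (grad_posdef u u0).
by have := u_min x (le_trans (ltW Wx) Ku); rewrite leNgt Vx.
Qed.
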